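(* Run the Uniform Budgeted Scheduler (UBS) described in the context, with a function $T$ satisfying the stated conditions and programs with halting times $\tau_j$. Let $(k,r)$ be a pair that UBS extracts and executes, with $T(k,r-1) < \tau_k$. Let $T_{\mathrm{UBS}}(k,r)$ be the total number of steps used by UBS (over all programs) after executing $(k,r)$, and for each $j \ge 1$ let $T_j(k,r) = \max\{T(j,m) : m \in \{0,1,2,\ldots\},\ T(j,m) \le T(k,r)\}$. Then $$T_{\mathrm{UBS}}(k,r) \le \sum_{j \ge 1} \min\{\tau_j, T_j(k,r)\}.$$
   Context: UBS runs programs indexed by $k \in \{1,2,\ldots\}$. Program $k$ halts when it has executed exactly $\tau_k \in \{1,2,\ldots\}\cup\{\infty\}$ steps in total; running program $k$ with budget $b$ resumes it from where it stopped and executes it for $b$ further steps or until it halts, whichever comes first. Let $T:\{1,2,\ldots\}\times\{0,1,2,\ldots\}\to\{0,1,2,\ldots\}$ satisfy $T(k,r) < T(k,r+1)$, $T(k,r) \le T(k+1,r)$ and $T(k,0) = 0$ for all $k,r$. UBS maintains a priority queue of pairs $(k,r)$ ordered by $T(k,r)$ (ties broken arbitrarily), initially containing $(1,1)$. While the queue is nonempty: extract a pair $(k,r)$ of minimal $T(k,r)$; run program $k$ with budget $T(k,r)-T(k,r-1)$ (its $r$-th segment); if program $k$ has not halted, insert $(k,r+1)$; if $r=1$, insert $(k+1,1)$. *)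

(* Defs.v *)
From HB Require Import structures.
From mathcomp Require Import all_boot all_order all_algebra.
From mathcomp Require Import all_classical all_reals all_analysis.

Set Implicit Arguments.
Unset Strict Implicit.
Unset Printing Implicit Defensive.

Import Order.TTheory GRing.Theory Num.Theory.

(* Programs are indexed by k >= 1 and segments by r >= 1; values of T and tau
   at k = 0 are irrelevant. *)

Definition admissible (T : nat -> nat -> nat) : Prop :=
  forall k r, (1 <= k)%N ->
    [/\ (T k r < T k r.+1)%N, (T k r <= T k.+1 r)%N & T k 0 = 0%N].

(* None stands for the halting time infinity. *)
Definition halting_times (tau : nat -> option nat) : Prop :=
  forall k, (1 <= k)%N -> tau k != Some 0.

Section Scheduler.
Variables (T : nat -> nat -> nat) (tau : nat -> option nat).

Definition halted (k p : nat) : bool := tau k == Some p.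

(* One step of execution. A run cannot jump over the halting time, as progress
   starts at 0 and grows by one. *)
Definition exec_one (k p : nat) : nat := if halted k p then p else p.+1.

Definition run (k b p : nat) : nat := iter b (exec_one k) p.

Record ubs_state := UBSState {
  queue : seq (nat * nat); (* a multiset: the order of the list is not used *)
  progress : nat -> nat;
  total_steps : nat
}.

Definition ubs_init : ubs_state := UBSState [:: (1, 1)] (fun=> 0) 0.

Definition is_min (q : seq (nat * nat)) (k r : nat) : Prop :=
  (k, r) \in q /\ forall x, x \in q -> (T k r <= T x.1 x.2)%N.

Definition execute (s : ubs_state) (k r : nat) : ubs_state :=
  let p := progress s k in
  let p' := run k (T k r - T k r.-1) p in
  UBSState ((if r == 1 then [:: (k.+1, 1)] else [::])
            ++ (if halted k p' then [::] else [:: (k, r.+1)])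
            ++ rem (k, r) (queue s))
           [eta progress s with k |-> p']
           (total_steps s + (p' - p)).

(* Ties are broken nondeterministically: any minimal pair may be extracted. *)
Inductive reachable : ubs_state -> Prop :=
| reachable_init : reachable ubs_init
| reachable_execute s k r :
    reachable s -> is_min (queue s) k r -> reachable (execute s k r).

End Scheduler.

(* max {T j m | m in nat, T j m <= B}: since T j is strictly increasing,
   T j m <= B forces m <= B, so the finite range loses nothing
   (see max_belowP). *)
Definition max_below (T : nat -> nat -> nat) (j B : nat) : nat :=
  \max_(m < B.+1 | T j m <= B) T j m.

Lemma max_belowP T j B : admissible T -> (1 <= j)%N ->
  (exists2 m, (T j m <= B)%N & max_below T j B = T j m) /\
  (forall m, (T j m <= B)%N -> (T j m <= max_below T j B)%N).
Proof.
move=> HT j1; have T0 : T j 0 = 0%N by case: (HT j 0 j1).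
have le_T m : (m <= T j m)%N.
  by elim: m => // m IH; case: (HT j m j1) => lt_T _ _; apply: leq_ltn_trans lt_T.
split.
  have P0 : (T j (@ord0 B) <= B)%N by rewrite /= T0.
  have [m Pm Em] := eq_bigmax_cond (fun m : 'I_B.+1 => T j m)
    (A := [pred m : 'I_B.+1 | T j m <= B])
    (ltac:(by apply/card_gt0P; exists ord0)).
  by exists m => //; rewrite -Em; apply: eq_bigl.
move=> m Hm; have lt_m : (m < B.+1)%N by rewrite ltnS (leq_trans (le_T m)).
exact: (@leq_bigmax_cond _ (fun i : 'I_B.+1 => T j i <= B)
  (fun i => T j i) (Ordinal lt_m) Hm).
Qed.

Definition ext_natr (R : realType) (x : option nat) : \bar R :=
  if x is Some n then (n%:R)%:E%E else +oo%E.

(* Main.v *)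
Require Import Defs.
From mathcomp Require Import all_boot all_order all_algebra.
From mathcomp Require Import all_classical all_reals all_analysis.

Import Order.TTheory GRing.Theory Num.Theory.

(** Pairs are extracted in nondecreasing order of [T], so at any time the
    progress of program [j] is at most some [T j m] which no queued pair beats.
    Executing a minimal [(k, r)] therefore leaves the progress of every [j] at
    most some [T j m <= T k r], hence at most [min (tau j) (T_j (k, r))], and
    the total number of steps is the sum of the progresses of the finitely many
    started programs, i.e. a partial sum of the series. *)

(** [N] is the largest program index ever queued; as [(N, 1)] is the only
    possible first segment, executing it never queues [(N.+1, 1)] twice. *)
Record ubs_invariant (T : nat -> nat -> nat) (tau : nat -> option nat)
    (s : ubs_state) (N : nat) : Prop := UbsInvariant {
  inv_pos : forall x, x \in queue s -> (1 <= x.1 <= N)%N /\ (1 <= x.2)%N;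
  inv_first : forall x, x \in queue s -> x.2 = 1%N -> x.1 = N;
  inv_uniq : uniq (map fst (queue s));
  inv_queue : forall x, x \in queue s -> (progress s x.1 <= T x.1 x.2.-1)%N;
  inv_tau : forall j t, tau j = Some t -> (progress s j <= t)%N;
  inv_below : forall j, (1 <= j)%N ->
    exists2 m, (progress s j <= T j m)%N &
      forall x, x \in queue s -> (T j m <= T x.1 x.2)%N;
  inv_unstarted : forall j, (N < j)%N -> progress s j = 0%N;
  inv_total : total_steps s = \sum_(1 <= j < N.+1) progress s j }.

Lemma run_ge tau k b p : (p <= run tau k b p)%N.
Proof.
elim: b => //= b /leq_trans; apply.
by rewrite /exec_one; case: ifP.
Qed.

Lemma run_le_add tau k b p : (run tau k b p <= p + b)%N.
Proof.
elim: b => [|b IHb] /=; first by rewrite addn0.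
rewrite /exec_one addnS; case: ifP => _ //.
exact: leq_trans IHb (leqnSn _).
Qed.

(** Since [halted] tests equality only, the bound rests on starting at or below [t] and advancing
    one step at a time. *)
Lemma run_le_tau tau k b p t : tau k = Some t -> (p <= t)%N ->
  (run tau k b p <= t)%N.
Proof.
move=> tauk ple; elim: b => //= b IHb.
rewrite /exec_one /halted -/(run tau k b p) tauk; case: eqP => // /eqP neq.
by rewrite ltn_neqAle IHb andbT; apply: contraNneq neq => ->.
Qed.

(** First components being distinct, removing [x] leaves no pair of its program. *)
Lemma mem_rem_queue (q : seq (nat * nat)) x y :
  uniq (map fst q) -> x \in q -> y \in rem x q -> y \in q /\ y.1 != x.1.
Proof.
move=> uq xq yr; split; first exact: mem_rem yr.
move: uq; rewrite (perm_uniq (perm_map fst (perm_to_rem xq))) /=.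
by case/andP=> /negP nx _; apply/eqP => e; apply: nx; rewrite -e map_f.
Qed.

Lemma ubs_invariant_init T tau : admissible T ->
  ubs_invariant T tau ubs_init 1.
Proof.
move=> HT; split=> //=.
- by move=> x; rewrite inE => /eqP ->.
- by move=> x; rewrite inE => /eqP ->.
- move=> j j1; exists 0%N => // x _.
  by have [_ _ ->] := HT j 0%N j1.
- by rewrite big_nat1.
Qed.

Section Execute.
Variables (T : nat -> nat -> nat) (tau : nat -> option nat).
Hypothesis HT : admissible T.
Variables (s : ubs_state) (N k r : nat).
Hypotheses (Is : ubs_invariant T tau s N) (Hkr : is_min T (queue s) k r).

Local Notation s' := (execute T tau s k r).

Lemma progress_executeE j : progress s' j =
  if j == k then run tau k (T k r - T k r.-1) (progress s k)
  else progress s j.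
Proof. by []. Qed.

(** Progress before extraction is at most [T k r.-1], and the budget is the gap from there to
    [T k r]. *)
Lemma progress_execute_le : (progress s' k <= T k r)%N.
Proof.
have [kq _] := Hkr; have [/andP[k1 _] r1] := inv_pos _ _ _ _ Is _ kq.
have ple := inv_queue _ _ _ _ Is _ kq.
rewrite progress_executeE eqxx (leq_trans (run_le_add _ _ _ _)) //.
have [lt_T _ _] := HT k r.-1 k1.
rewrite prednK // in lt_T.
by rewrite -(subnKC (ltnW lt_T)) addKn leq_add2r.
Qed.

Lemma progress_execute_below j : (1 <= j)%N ->
  exists2 m, (progress s' j <= T j m)%N & (T j m <= T k r)%N.
Proof.
move=> j1; have [-> | neq] := eqVneq j k.
  by exists r => //; exact: progress_execute_le.
(* A program other than [k] does not move, and its [T j m] is at most the key of every queued pair,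
   in particular of [(k, r)]. *)
have [m pm mq] := inv_below _ _ _ _ Is j j1.
exists m; first by rewrite progress_executeE (negbTE neq).
by have [kq _] := Hkr; exact: mq kq.
Qed.

Lemma progress_execute_tau j t : tau j = Some t -> (progress s' j <= t)%N.
Proof.
move=> tauj; rewrite progress_executeE; case: eqP => [e | _].
  by rewrite e in tauj; apply: run_le_tau => //; apply: inv_tau Is _ _ _.
exact: inv_tau Is _ _ tauj.
Qed.

Lemma total_execute :
  total_steps s' = \sum_(1 <= j < N.+1) progress s' j.
Proof.
have [kq _] := Hkr; have [kN _] := inv_pos _ _ _ _ Is _ kq.
have kI : k \in index_iota 1 N.+1 by rewrite mem_index_iota.
rewrite [LHS]/= (inv_total _ _ _ _ Is).
rewrite !(bigD1_seq k _ (iota_uniq _ _)) //.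
(* Only summand [k] changes; a run never lowers progress, so the truncated subtraction [p' - p] is
   exact. *)
rewrite [in RHS]progress_executeE eqxx [LHS]addnAC subnKC ?run_ge //; congr addn.
by apply: eq_bigr => j /negbTE nj; rewrite progress_executeE nj.
Qed.

Lemma queue_execute x : x \in queue s' ->
  [\/ r = 1%N /\ x = (k.+1, 1%N), x = (k, r.+1)
    | x \in queue s /\ x.1 != k].
Proof.
have [kq _] := Hkr.
rewrite /execute /= !mem_cat => /or3P[].
- by case: eqP => // r1; rewrite inE => /eqP ->; constructor 1.
- by case: ifP => // _; rewrite inE => /eqP ->; constructor 2.
- by move/(mem_rem_queue _ _ _ (inv_uniq _ _ _ _ Is) kq); constructor 3.
Qed.

(** Keys never drop below the extracted one: [T] increases in the segment, which covers [(k, r.+1)],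
    and is monotone in the program, which covers [(k.+1, 1)]; the other pairs were queued when
    [(k, r)] was minimal. *)
Lemma queue_execute_ge x : x \in queue s' -> (T k r <= T x.1 x.2)%N.
Proof.
have [kq kmin] := Hkr; have [/= /andP[k1 _] _] := inv_pos _ _ _ _ Is _ kq.
have [lt_T le_T _] := HT k r k1.
case/queue_execute => [[r1 ->] | -> | [xq _]] /=.
- by move: le_T; rewrite r1.
- exact: ltnW.
- exact: kmin.
Qed.

Lemma ubs_invariant_execute :
  ubs_invariant T tau s' (if r == 1%N then N.+1 else N).
Proof.
have [kq _] := Hkr; have [/= /andP[k1 kN] r1] := inv_pos _ _ _ _ Is _ kq.
have kE : r = 1%N -> k = N := inv_first _ _ _ _ Is _ kq.
have leN : (N <= if r == 1%N then N.+1 else N)%N by case: ifP.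
split.
- move=> x /queue_execute[[e ->] | -> | [xq _]] /=.
  + by rewrite e /= ltnS kN.
  + by rewrite k1 (leq_trans kN).
  + have [/andP[x1 xN] x2] := inv_pos _ _ _ _ Is _ xq.
    by rewrite x1 (leq_trans xN).
- move=> x /queue_execute[[e ->] | -> /= | [xq nx]] /=.
  + by rewrite e /= kE.
  + by case=> r0; rewrite r0 in r1.
  + move=> x2; case: eqP => [/kE e|_]; last exact: inv_first Is _ xq x2.
    (* If [r] is 1 then [k] is [N], so a remaining first segment would belong to [k] too. *)
    by rewrite e (inv_first _ _ _ _ Is _ xq x2) eqxx in nx.
- have uq := inv_uniq _ _ _ _ Is.
  have nk y : y \in map fst (rem (k, r) (queue s)) -> y != k /\ (y <= N)%N.
    case/mapP=> x /(mem_rem_queue _ _ _ uq kq)[xq nx] ->.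
    by have [/andP[_ xN] _] := inv_pos _ _ _ _ Is _ xq.
  have ur : uniq (map fst (rem (k, r) (queue s))).
    by move: uq; rewrite (perm_uniq (perm_map fst (perm_to_rem kq))) => /andP[].
  have u2 : uniq (map fst ((if halted tau k (progress s' k)
      then [::] else [:: (k, r.+1)]) ++ rem (k, r) (queue s))).
    case: ifP => //= _; rewrite ur andbT.
    by apply/negP => /nk[]; rewrite eqxx.
  rewrite progress_executeE eqxx in u2; rewrite /execute /=; case: (r =P 1%N) => //= e; rewrite u2 andbT.
  (* The new index [k.+1] is fresh: it differs from [k], and all remaining indices are at most
     [N = k]. *)
  rewrite map_cat mem_cat negb_or; apply/andP; split.
    by case: ifP => //= _; rewrite inE gtn_eqF.
  by apply/negP => /nk[_]; rewrite (kE e) ltnn.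
- move=> x /queue_execute[[e ->] | -> | [xq nx]].
  (* Program [k.+1] is [N.+1], which has not run yet. *)
  + rewrite progress_executeE /= gtn_eqF //.
    by rewrite (inv_unstarted _ _ _ _ Is) // kE.
  + exact: progress_execute_le.
  + rewrite progress_executeE (negbTE nx).
    exact: inv_queue Is _ xq.
- exact: progress_execute_tau.
- move=> j /progress_execute_below[m pm mT]; exists m => // x xq.
  exact: leq_trans mT (queue_execute_ge _ xq).
- move=> j Nj; have {}Nj := leq_ltn_trans leN Nj.
  rewrite progress_executeE gtn_eqF ?(leq_ltn_trans kN) //.
  exact: inv_unstarted Is _ Nj.
(* When [r] is 1 the range gains [N.+1], whose progress is still 0. *)
- rewrite total_execute; case: eqP => // /kE e.
  rewrite [RHS]big_nat_recr //= gtn_eqF ?e //.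
  by rewrite (inv_unstarted _ _ _ _ Is _ (ltnSn N)) addn0.
Qed.

End Execute.

Lemma reachable_invariant T tau s : admissible T -> reachable T tau s ->
  exists N, ubs_invariant T tau s N.
Proof.
move=> HT; elim=> {s} [|s k r _ [N Is] Hkr].
  by exists 1%N; exact: ubs_invariant_init.
by eexists; exact: ubs_invariant_execute Is Hkr.
Qed.

Theorem theorem2 (R : realType) (T : nat -> nat -> nat) (tau : nat -> option nat)
    (HT : admissible T) (Htau : halting_times tau)
    (s : ubs_state) (k r : nat)
    (Hs : reachable T tau s) (Hkr : is_min T (queue s) k r)
    (Hlt : ((T k r.-1)%:R%:E < ext_natr R (tau k))%E) :
  ((total_steps (execute T tau s k r))%:R%:E
   <= \sum_(1 <= j <oo)
        Order.min (ext_natr R (tau j)) (max_below T j (T k r))%:R%:E)%E.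
Proof.
have [N Is] := reachable_invariant _ _ _ HT Hs.
set u := fun j => Order.min (ext_natr R (tau j)) (max_below T j (T k r))%:R%:E.
have u_ge0 j : (0 <= u j)%E.
  rewrite /u le_min lee_fin ler0n andbT /ext_natr.
  by case: (tau j) => [t|]; rewrite ?lee_fin ?ler0n ?leey.
(* Programs beyond [N] have not run, so a partial sum of the nonnegative series suffices. *)
apply: (@le_trans _ _ (\sum_(1 <= j < N.+1) u j)%E); last first.
  by apply: nneseries_lim_ge => j _ _; exact: u_ge0.
rewrite (total_execute _ _ _ _ _ _ Is Hkr) natr_sum -sumEFin.
rewrite big_seq [leRHS]big_seq; apply: lee_sum => j.
rewrite mem_index_iota => /andP[j1 _].
rewrite /u le_min; apply/andP; split.
  rewrite /ext_natr; case tauj: (tau j) => [t|]; last by rewrite leey.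
  rewrite lee_fin ler_nat.
  exact: progress_execute_tau Is _ _ tauj.
(* The bound [T j m <= T k r] puts [T j m] among the values whose maximum is taken. *)
have [m pm mT] := progress_execute_below _ _ HT _ _ _ _ Is Hkr _ j1.
have [_ max_ge] := max_belowP (T k r) HT j1.
by rewrite lee_fin ler_nat (leq_trans pm) // max_ge.
Qed.
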